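(* The Chinese Restaurant Process $CRP(\theta)$ is the only exchangeable random partition with independent increments. That is, for an exchangeable random partition $\Pi_n$ of $[n]=\{1,\ldots,n\}$, the increments $X_1,\ldots,X_n$ of $\Pi_n$ are independent if and only if $\Pi_n$ has the distribution of $CRP(\theta)$ on $[n]$ for some $\theta>0$.
   Context: A random partition of $[n]=\{1,\ldots,n\}$ is a random variable with values in the finite set of set partitions of $[n]$. The blocks $A_1,\ldots,A_k$ of a partition are listed in order of appearance, i.e. in increasing order of their smallest elements. A composition of $n$ is an ordered tuple of positive integers summing to $n$. A random partition $\Pi_n$ of $[n]$ is called exchangeable if there is a function $p$ on the set of compositions of $n$ such that $P(\Pi_n=\{A_1,\ldots,A_k\})=p(|A_1|,\ldots,|A_k|)$ for every partition $\{A_1,\ldots,A_k\}$ of $[n]$, and $p$ is symmetric (so the probability depends on the sizes of the blocks but not on their order). The increments of a partition of $[n]$ are the sequence $(X_1,\ldots,X_n)$ where $X_i=1$ if $i$ is the smallest element of the block containing it, and $X_i=0$ otherwise (so $X_1=1$ always). For $\theta>0$, the Chinese Restaurant Process with parameter $\theta$, denoted $CRP(\theta)$, is the exchangeable random partition of $[n]$ with distribution given by $$p(n_1,\ldots,n_k)=\frac{\theta^k\prod_{i=1}^k (n_i-1)!}{\prod_{i=0}^{n-1}(\theta+i)}.$$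
   Formalization: For n ≥ 2 the partition a.s. equal to {[n]} and the one a.s. equal to all singletons are exchangeable with constant, hence independent, increments but are not CRP(θ) for any θ>0; the formal equivalence lists these two laws as additional alternatives to CRP(θ). *)

(* Defs.v *)
From mathcomp Require Import all_boot all_algebra.

Set Implicit Arguments.
Unset Strict Implicit.
Unset Printing Implicit Defensive.

(* Everything is indexed from 0: i : 'I_n stands for the element i.+1 of
   {1, ..., n}, so the first increment X_1 is [increment B ord0]. *)

Definition set_partition (n : nat) (B : {set {set 'I_n}}) : bool :=
  partition B [set: 'I_n].

(* The default value n is only returned on the empty set. *)
Definition least (n : nat) (A : {set 'I_n}) : nat :=
  \big[minn/n]_(i in A) (i : nat).

Definition blocks (n : nat) (B : {set {set 'I_n}}) : seq {set 'I_n} :=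
  sort (fun A A' => least A <= least A') (enum B).

Definition block_sizes (n : nat) (B : {set {set 'I_n}}) : seq nat :=
  [seq #|A : {set 'I_n}| | A <- blocks B].

Definition composition (n : nat) (s : seq nat) : bool :=
  all (fun m => 0 < m) s && (sumn s == n).

Definition increment (n : nat) (B : {set {set 'I_n}}) (i : 'I_n) : nat :=
  if (i : nat) == least (pblock B i) then 1 else 0.

Definition one_block (n : nat) : {set {set 'I_n}} := [set [set: 'I_n]].

Definition all_singletons (n : nat) : {set {set 'I_n}} :=
  [set [set i] | i : 'I_n].

From mathcomp Require Import all_classical all_reals all_analysis.
Import GRing.Theory Num.Theory.

Local Open Scope classical_set_scope.
Local Open Scope ring_scope.

(* The finite set of partitions carries its discrete sigma-algebra. *)
Definition random_partition (d : measure_display) (T : measurableType d)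
    (n : nat) (Pi : T -> {set {set 'I_n}}) : Prop :=
  (forall w, set_partition (Pi w)) /\
  (forall C : set {set {set 'I_n}}, measurable (Pi @^-1` C)).

(* The function p is only constrained on the compositions of n. *)
Definition exchangeable (R : realType) (d : measure_display)
    (T : measurableType d) (P : probability T R)
    (n : nat) (Pi : T -> {set {set 'I_n}}) : Prop :=
  exists p : seq nat -> R,
    (forall B, set_partition B ->
       P [set w | Pi w = B] = (p (block_sizes B))%:E) /\
    (forall s t, composition n s -> composition n t ->
       perm_eq s t -> p s = p t).

Definition independent_RVs (R : realType) (d : measure_display)
    (T : measurableType d) (P : probability T R)
    (d' : measure_display) (V : measurableType d')
    (I : finType) (X : I -> T -> V) : Prop :=
  forall (J : {set I}) (A : I -> set V),
    (forall i, measurable (A i)) ->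
    P (\bigcap_(i in [set i | i \in J]) (X i @^-1` A i)) =
    (\prod_(i in J) P (X i @^-1` A i))%E.

Definition crp_eppf (R : realType) (theta : R) (n : nat) (s : seq nat) : R :=
  theta ^+ size s * (\prod_(m <- s) (m.-1)`!%:R) /
  \prod_(i < n) (theta + i%:R).

Definition has_CRP_law (R : realType) (d : measure_display)
    (T : measurableType d) (P : probability T R) (theta : R)
    (n : nat) (Pi : T -> {set {set 'I_n}}) : Prop :=
  forall B, set_partition B ->
    P [set w | Pi w = B] = (crp_eppf theta n (block_sizes B))%:E.

(* Main.v *)
Require Import Defs.
From mathcomp Require Import all_classical all_reals all_analysis.
From mathcomp Require Import all_boot all_order all_algebra all_fingroup.
From mathcomp Require Import zify.

Set Implicit Arguments.
Unset Strict Implicit.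
Unset Printing Implicit Defensive.

(** Encode the increments of a partition by the set of its block minima, and
let q_i be the probability that i is a block minimum, with elements counted
from 0, so that q_0 = 1. Independence of the increments says that the set of
minima is S with probability the product of the q_i over S and of the 1 - q_i
off S.

The Chinese Restaurant Process satisfies this with q_i = theta / (theta + i)
and 1 - q_i = i / (theta + i). The point is that the products of the (|A|-1)!,
summed over the partitions whose set of minima is S, give the product of the i
not in S ([sum_cyclic_orders]): both sides count the maps that send every i
not in S to a smaller element. The degenerate laws have constant increments,
so one criterion ([product_mass_independent]) covers the whole converse.

Conversely, let an exchangeable law have independent increments, with n > 1.
- If q_1 = 0, two elements never lie in different blocks, by relabelling, and
  the partition is the one-block partition ([one_block_of_never_split]).
- If q_1 > 0, all q_i are positive ([increment_prob_positive]): some partition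
  of positive probability has exactly the i with q_i > 0 as minima, and
  exchangeability gives all its relabellings the same set of minima, to which
  0 and 1 belong; then no two of its elements share a block.
- In that case compare the partitions in which i is the only element that is
  not a minimum. They have one block of size 2 and singletons, so they share
  one probability g, and there are i of them: one for each smaller element
  that can be the partner of i. Hence i g = (1 - q_i) prod_(j <> i) q_j
  ([one_missing_mass]). If g = 0 then all q_i are 1 and every block is a
  singleton; otherwise i q_i / (1 - q_i) is a constant theta, that is
  q_i = theta / (theta + i).

It remains to see that an exchangeable law is determined by the law of its
increments ([eppf_unique]). Among the partitions on which two such laws differ,
take one whose minima come as late as possible, in lexicographic order. Its
blocks are intervals, or else exchanging two elements would delay a minimum;
and an interval partition is determined by its minima, so no other partition
with these minima carries a difference. As both laws give the same total
probability to the partitions with these minima, they agree on this one too, a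
contradiction. *)

(** * Block minima and relabellings *)

Definition minima (n : nat) (B : {set {set 'I_n}}) : {set 'I_n} :=
  [set i | increment B i == 1].

(** The action of permutations on partitions: exchangeability is invariance
    under it, and it carries blocks to blocks of the same size. *)
Definition relabel (n : nat) (s : {perm 'I_n}) (B : {set {set 'I_n}}) :
    {set {set 'I_n}} :=
  [set s @: (A : {set 'I_n}) | A in B].

Lemma mem_pblockT (n : nat) (B : {set {set 'I_n}}) (i : 'I_n) :
  set_partition B -> i \in pblock B i.
Proof. by move=> /and3P[/eqP cB _ _]; rewrite mem_pblock cB inE. Qed.

Lemma pblock_memT (n : nat) (B : {set {set 'I_n}}) (i : 'I_n) :
  set_partition B -> pblock B i \in B.
Proof. by move=> /and3P[/eqP cB _ _]; rewrite pblock_mem // cB inE. Qed.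

Lemma eq_pblockT (n : nat) (B : {set {set 'I_n}}) (i j : 'I_n) :
  set_partition B -> (pblock B i == pblock B j) = (j \in pblock B i).
Proof. by move=> /and3P[/eqP cB tB _]; rewrite eq_pblock // cB inE. Qed.

Lemma blockP (n : nat) (B : {set {set 'I_n}}) (A : {set 'I_n}) :
  set_partition B -> reflect (exists i, A = pblock B i) (A \in B).
Proof.
move=> pB; have /and3P[_ tB n0B] := pB.
apply: (iffP idP) => [AB|[i ->]]; last exact: pblock_memT.
have [A0|[i iA]] := set_0Vmem A; first by rewrite -A0 AB in n0B.
by exists i; rewrite (def_pblock tB AB iA).
Qed.

Lemma partition_ext (n : nat) (B B' : {set {set 'I_n}}) :
  set_partition B -> set_partition B' ->
  (forall i j, (pblock B i == pblock B j) = (pblock B' i == pblock B' j)) ->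
  B = B'.
Proof.
move=> pB pB' eqBB'.
have eqb i : pblock B i = pblock B' i.
  by apply/setP=> j; rewrite -!eq_pblockT.
apply/setP=> A; apply/(blockP A pB)/(blockP A pB') => -[i ->]; exists i.
- exact: eqb.
- by rewrite eqb.
Qed.

Lemma least_eqP (n : nat) (A : {set 'I_n}) (i : 'I_n) : i \in A ->
  reflect (forall j : 'I_n, j \in A -> i <= j) ((i : nat) == least A).
Proof.
have leastP j : j \in A -> least A <= j.
  move=> jA; rewrite /least.
  elim: (index_enum _) (mem_index_enum j) => [|k r IHr] //.
  rewrite inE big_cons => /predU1P[<-|/IHr le_j]; first by rewrite jA geq_minl.
  by case: ifP => // _; apply: leq_trans le_j; apply: geq_minr.
move=> iA; apply: (iffP eqP) => [-> //|iP].
apply/eqP; rewrite eqn_leq leastP // andbT /least.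
apply: (big_ind (fun m => i <= m)) => //; first exact: ltnW.
by move=> x y ix iy; rewrite leq_min ix.
Qed.

Lemma minimaP (n : nat) (B : {set {set 'I_n}}) (i : 'I_n) : set_partition B ->
  reflect (forall j : 'I_n, pblock B i = pblock B j -> i <= j)
          (i \in minima B).
Proof.
move=> pB; rewrite inE /increment.
have -> : ((if (i : nat) == least (pblock B i) then 1 else 0) == 1)
    = ((i : nat) == least (pblock B i)) by case: ifP.
apply: (iffP (least_eqP (mem_pblockT i pB))) => iP j.
- by move/eqP; rewrite eq_pblockT //; apply: iP.
- by rewrite -eq_pblockT // => /eqP; apply: iP.
Qed.

Lemma minimaE (n : nat) (B : {set {set 'I_n}}) (i : 'I_n) : set_partition B ->
  (i \in minima B) =
  ~~ [exists j : 'I_n, (pblock B i == pblock B j) && (j < i)].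
Proof.
move=> pB; apply/(minimaP i pB)/existsPn => iP j.
  by apply/negP => /andP[/eqP /iP leij]; rewrite ltnNge leij.
by move=> eqij; have := iP j; rewrite eqij eqxx /= -leqNgt.
Qed.

Lemma minima_lt (n : nat) (B : {set {set 'I_n}}) (i : 'I_n) : set_partition B ->
  reflect (exists2 j : 'I_n, pblock B i = pblock B j & j < i)
          (i \notin minima B).
Proof.
move=> pB; apply: (iffP idP) => [iM|[j eqij ltji]]; last first.
  by apply/(minimaP i pB) => /(_ _ eqij); rewrite leqNgt ltji.
by move: iM; rewrite minimaE // negbK => /existsP[j /andP[/eqP]]; exists j.
Qed.

Lemma pblock_inj_minima (n : nat) (B : {set {set 'I_n}}) : set_partition B ->
  {in minima B &, injective (pblock B)}.
Proof.
move=> pB i j /(minimaP i pB) iP /(minimaP j pB) jP eqij.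
by apply/val_inj/eqP; rewrite eqn_leq iP //= jP.
Qed.

Lemma pblock_minimum (n : nat) (B : {set {set 'I_n}}) (i : 'I_n) :
  set_partition B -> exists2 j, j \in minima B & pblock B j = pblock B i.
Proof.
move=> pB; have iP : pblock B i == pblock B i by [].
case: (@arg_minnP _ i (fun j => pblock B i == pblock B j) val iP) => j.
move=> /eqP eqij jP; exists j => //.
by apply/(minimaP j pB) => k eqjk; apply: jP; rewrite eqij eqjk.
Qed.

(** Sending an element to its block is a bijection from minima to blocks. *)
Lemma card_minima (n : nat) (B : {set {set 'I_n}}) :
  set_partition B -> #|minima B| = #|B|.
Proof.
move=> pB; rewrite -(card_in_imset (pblock_inj_minima pB)); apply/esym/eq_card.
move=> A; apply/(blockP A pB)/imsetP => [[i ->]|[i _ ->]]; last by exists i.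
by have [j jM <-] := pblock_minimum i pB; exists j.
Qed.

Lemma ord0_minima (n : nat) (B : {set {set 'I_n}}) (i : 'I_n) :
  set_partition B -> i = 0 :> nat -> i \in minima B.
Proof. by move=> pB i0; apply/(minimaP i pB) => j _; rewrite i0. Qed.

Lemma relabel_partition (n : nat) (s : {perm 'I_n}) (B : {set {set 'I_n}}) :
  set_partition B -> set_partition (relabel s B).
Proof.
move=> pB; have /and3P[_ tB n0B] := pB.
have sinj : injective (fun A : {set 'I_n} => s @: A).
  exact/imset_inj/perm_inj.
apply/and3P; split.
- apply/eqP/setP=> i; rewrite inE; apply/bigcupP.
  exists (s @: pblock B ((s^-1)%g i)); first by rewrite imset_f // pblock_memT.
  by apply/imsetP; exists ((s^-1)%g i); rewrite ?permKV // mem_pblockT.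
- apply/trivIsetP => _ _ /imsetP[A AB ->] /imsetP[A' A'B ->].
  rewrite (inj_eq sinj) => /(trivIsetP tB _ _ AB A'B) dAA'.
  by rewrite imset_disjoint //; apply: perm_inj.
- apply/imsetP => -[A AB /esym/eqP]; rewrite imset_eq0 => /eqP A0.
  by rewrite -A0 AB in n0B.
Qed.

Lemma pblock_relabel (n : nat) (s : {perm 'I_n}) (B : {set {set 'I_n}})
    (i j : 'I_n) : set_partition B ->
  (pblock (relabel s B) (s i) == pblock (relabel s B) (s j)) =
  (pblock B i == pblock B j).
Proof.
move=> pB; have /and3P[_ tsB _] := relabel_partition s pB.
have pE k : pblock (relabel s B) (s k) = s @: pblock B k.
  apply: (def_pblock tsB); first by rewrite imset_f // pblock_memT.
  by rewrite imset_f // mem_pblockT.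
by rewrite !pE (inj_eq (imset_inj (@perm_inj _ s))).
Qed.

Lemma card_relabel (n : nat) (s : {perm 'I_n}) (B : {set {set 'I_n}}) :
  #|relabel s B| = #|B|.
Proof. exact/card_imset/imset_inj/perm_inj. Qed.

Lemma perm_block_sizes (n : nat) (B : {set {set 'I_n}}) :
  perm_eq (block_sizes B) [seq #|(A : {set 'I_n})| | A <- enum B].
Proof. by rewrite /block_sizes /blocks; apply/perm_map; rewrite perm_sort. Qed.

Lemma block_sizes_relabel (n : nat) (s : {perm 'I_n}) (B : {set {set 'I_n}}) :
  perm_eq (block_sizes (relabel s B)) (block_sizes B).
Proof.
apply: perm_trans (perm_block_sizes _) _.
rewrite perm_sym; apply: perm_trans (perm_block_sizes _) _.
have -> : [seq #|(A : {set 'I_n})| | A <- enum B] =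
    [seq #|(A : {set 'I_n})| | A <- [seq s @: (A : {set 'I_n}) | A in B]].
  by rewrite -map_comp; apply: eq_map => A /=; rewrite card_imset //; apply: perm_inj.
apply/perm_map/uniq_perm.
- rewrite map_inj_uniq ?enum_uniq //; exact/imset_inj/perm_inj.
- exact: enum_uniq.
- by move=> A; rewrite mem_enum; apply/imageP/imsetP.
Qed.

Lemma block_sizes_composition (n : nat) (B : {set {set 'I_n}}) :
  set_partition B -> composition n (block_sizes B).
Proof.
move=> pB; have /and3P[_ _ n0B] := pB; apply/andP; split.
  rewrite (perm_all _ (perm_block_sizes B)) all_map; apply/allP => A.
  rewrite mem_enum /= card_gt0 => AB; apply: contraNneq n0B => <-; exact: AB.
rewrite (perm_sumn (perm_block_sizes B)) sumnE big_map big_enum /=.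
by rewrite -(card_partition pB) cardsT card_ord.
Qed.

Lemma size_block_sizes (n : nat) (B : {set {set 'I_n}}) :
  size (block_sizes B) = #|B|.
Proof. by rewrite (perm_size (perm_block_sizes B)) size_map -cardE. Qed.

(** * Counting the partitions with given minima *)

(** The elements of A other than the least have ranks 1, ..., |A| - 1; the
    maximum with 1 neutralises the rank 0 of the least element. Induction
    removes the greatest element, whose rank is |A| - 1. *)
Lemma prod_rank (n : nat) (A : {set 'I_n}) :
  \prod_(i in A) maxn 1 #|[set j in A | j < i]| = (#|A|.-1)`!.
Proof.
elim: {A}_.+1 {-2}A (ltnSn #|A|) => // m IHm A; rewrite ltnS => leAm.
have [->|[i iA]] := set_0Vmem A; first by rewrite big_set0 cards0.
case: (@arg_maxnP _ i (fun j => j \in A) val iA) => a aA a_max.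
have cA := cardsD1 a A; rewrite aA add1n in cA.
have rank_a : [set j in A | j < a] = A :\ a.
  apply/setP=> j; rewrite !inE andbC; case jA: (j \in A); rewrite ?andbF //.
  by rewrite ltn_neqAle -val_eqE (a_max _ jA : j <= a) !andbT.
rewrite (bigD1 a) //= rank_a (eq_bigl (fun i => i \in A :\ a)); last first.
  by move=> j; rewrite !inE andbC.
rewrite (eq_bigr (fun i : 'I_n => maxn 1 #|[set j in A :\ a | j < i]|)).
  rewrite IHm; last by rewrite -ltnS -cA.
  by rewrite cA /=; case: #|A :\ a| => // k; rewrite (maxn_idPr _).
move=> j /setD1P[neja jA]; congr (maxn 1 #|pred_of_set _|); apply/setP => k.
rewrite !inE; case: eqP => // ->.
have -> : (a < j) = false by apply/negbTE; rewrite -leqNgt; exact: a_max.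
by rewrite andbF.
Qed.

Lemma prodn_bool (I : finType) (b : I -> bool) :
  \prod_i (b i : nat) = [forall i, b i].
Proof.
have [/forallP b1|/forallPn[i /negbTE bi]] := boolP [forall i, b i].
  by rewrite big1 // => i _; rewrite b1.
by rewrite (bigD1 i) //= bi mul0n.
Qed.

(** A map h with [parent_ok S i (h i)] for all i is a forest of increasing
    trees on [0, n) whose roots, the fixed points of h, are the elements of
    S. *)
Definition parent_ok (n : nat) (S : {set 'I_n}) (i j : 'I_n) : bool :=
  if i \in S then j == i else j < i.

(** The root of the tree of i: a path towards the root is strictly decreasing,
    so n steps always reach it. *)
Definition root (n : nat) (h : {ffun 'I_n -> 'I_n}) (i : 'I_n) : 'I_n :=
  iter n h i.

Section Forest.
Context (n : nat) (S : {set 'I_n}) (h : {ffun 'I_n -> 'I_n})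
  (h_ok : forall i, parent_ok S i (h i)).

Lemma parent_fix i : i \in S -> h i = i.
Proof. by move=> iS; have := h_ok i; rewrite /parent_ok iS => /eqP. Qed.

Lemma parent_lt i : i \notin S -> h i < i.
Proof. by move=> /negbTE iS; have := h_ok i; rewrite /parent_ok iS. Qed.

Lemma root_in i : root h i \in S.
Proof.
suff ancestorP k : (iter k h i \in S) || (iter k h i + k <= i).
  case/orP: (ancestorP n) => // /(leq_trans (leq_addl _ _)).
  by rewrite leqNgt ltn_ord.
elim: k => [|k IHk]; first by rewrite addn0 leqnn orbT.
have [kS|kS] := boolP (iter k h i \in S); first by rewrite iterS parent_fix ?kS.
rewrite (negbTE kS) /= in IHk; apply/orP; right; rewrite iterS addnS.
by apply: leq_trans IHk; rewrite ltn_add2r parent_lt.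
Qed.

Lemma root_fix i : i \in S -> root h i = i.
Proof. by move=> iS; apply: iter_fix; exact: parent_fix. Qed.

Lemma root_parent i : root h (h i) = root h i.
Proof. by rewrite /root -iterSr iterS parent_fix // root_in. Qed.

Lemma root_leq i : root h i <= i.
Proof.
suff iter_leq k : iter k h i <= i by exact: iter_leq.
elim: k => //= k IHk; apply: leq_trans IHk.
have [kS|kS] := boolP (iter k h i \in S); first by rewrite parent_fix.
exact/ltnW/parent_lt.
Qed.

(** The trees of a forest are the blocks of a partition, with the roots as
    minima. *)
Lemma forest_partition : exists B : {set {set 'I_n}},
  [/\ set_partition B, minima B = S & forall i, pblock B i = pblock B (h i)].
Proof.
pose B := preim_partition (root h) [set: 'I_n].
have pB : set_partition B by exact: preim_partitionP.
have BE i j : (pblock B i == pblock B j) = (root h i == root h j).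
  rewrite eq_pblockT // pblock_equivalence_partition ?inE // => x y z _ _ _.
  by split=> // /eqP ->.
exists B; split=> // [|i]; last by apply/eqP; rewrite BE root_parent.
apply/setP=> i; apply/(minimaP i pB)/idP => [iP|iS j /eqP].
- apply: contraT => iS; have := parent_lt iS; rewrite ltnNge iP //.
  by apply/eqP; rewrite BE root_parent.
- by rewrite BE (root_fix iS) => /eqP ->; apply: root_leq.
Qed.

(** If every element shares its block with its parent, the blocks are unions of
    trees, and distinct roots lie in distinct blocks because they are minima. *)
Lemma forest_partition_uniq (B B' : {set {set 'I_n}}) :
  set_partition B -> set_partition B' -> minima B = S -> minima B' = S ->
  (forall i, pblock B i = pblock B (h i)) ->
  (forall i, pblock B' i = pblock B' (h i)) -> B = B'.
Proof.
have pblockE (C : {set {set 'I_n}}) i j : set_partition C -> minima C = S ->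
    (forall i, pblock C i = pblock C (h i)) ->
    (pblock C i == pblock C j) = (root h i == root h j).
  move=> pC mC hC; have rootC k : pblock C (root h k) = pblock C k.
    suff iterC m : pblock C (iter m h k) = pblock C k by exact: iterC.
    by elim: m => //= m <-; rewrite -hC.
  rewrite -(rootC i) -(rootC j); apply/eqP/eqP => [|-> //].
  by apply: (pblock_inj_minima pC); rewrite mC root_in.
move=> pB pB' mB mB' hB hB'; apply: partition_ext => // i j.
by rewrite !pblockE.
Qed.

End Forest.

(** A minimum has one possible parent, itself; any other element i of a block
    can choose among the elements of its block below i. *)
Lemma sum_parent_ok (n : nat) (B : {set {set 'I_n}}) (i : 'I_n) :
  set_partition B ->
  \sum_j (parent_ok (minima B) i j && (pblock B i == pblock B j) : nat) =
  maxn 1 #|[set j in pblock B i | j < i]|.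
Proof.
move=> pB.
have -> : \sum_j (parent_ok (minima B) i j && (pblock B i == pblock B j) : nat)
    = #|[set j | parent_ok (minima B) i j & pblock B i == pblock B j]|.
  by rewrite -sum1_card [RHS]big_mkcond; apply: eq_bigr => j _; rewrite inE; case: ifP.
rewrite /parent_ok; case: (boolP (i \in minima B)) => iM.
  have -> : [set j in pblock B i | j < i] = set0.
    apply/setP=> j; rewrite !inE -eq_pblockT //; apply/negP => /andP[/eqP eqij].
    by rewrite ltnNge => /negP; apply; apply: (minimaP i pB).
  rewrite cards0; have -> : [set j | j == i & pblock B i == pblock B j] = [set i].
    by apply/setP=> j; rewrite !inE; case: eqP => // ->; rewrite eqxx.
  by rewrite cards1.
have -> : [set j : 'I_n | j < i & pblock B i == pblock B j] =
    [set j in pblock B i | j < i].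
  by apply/setP=> j; rewrite !inE -eq_pblockT // andbC.
apply/esym/maxn_idPr; rewrite card_gt0; apply/set0Pn.
have /(minima_lt i pB)[j /eqP eqij ltji] := iM.
by exists j; rewrite inE -eq_pblockT ?eqij.
Qed.

(** Given B, the product of the (|A|-1)! counts the increasing forests whose
    trees are the blocks of B. Each forest comes from exactly one B, so the sum
    counts all increasing forests with set of roots S. *)
Lemma sum_cyclic_orders (n : nat) (S : {set 'I_n}) :
  \sum_(B : {set {set 'I_n}} | set_partition B && (minima B == S))
     \prod_(A in B) (#|(A : {set 'I_n})|.-1)`! =
  \prod_(i : 'I_n | i \notin S) (i : nat).
Proof.
transitivity (\sum_(B : {set {set 'I_n}} | set_partition B && (minima B == S))
    \sum_(h : {ffun 'I_n -> 'I_n})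
      [forall i, parent_ok S i (h i) && (pblock B i == pblock B (h i))] : nat).
  apply: eq_bigr => B /andP[pB /eqP <-].
  under [RHS]eq_bigr => h _ do rewrite -prodn_bool.
  rewrite -(bigA_distr_bigA (fun i j =>
    parent_ok (minima B) i j && (pblock B i == pblock B j) : nat)).
  under [RHS]eq_bigr => i _ do rewrite sum_parent_ok //.
  transitivity (\prod_(i in [set: 'I_n]) maxn 1 #|[set j in pblock B i | j < i]|).
    rewrite (set_partition_big _ pB); apply: eq_bigr => A AB; rewrite -prod_rank.
    apply: eq_bigr => i iA; have /and3P[_ tB _] := pB.
    by rewrite (def_pblock tB AB iA).
  by apply: eq_bigl => i; rewrite inE.
rewrite exchange_big /=.
transitivity (\sum_(h : {ffun 'I_n -> 'I_n}) \prod_i (parent_ok S i (h i) : nat)).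
  apply: eq_bigr => h _; rewrite prodn_bool.
  have [/forallP h_ok|h_ok] := boolP [forall i, parent_ok S i (h i)]; last first.
    apply: big1 => B _; apply/eqP; rewrite eqb0; apply: contra h_ok.
    by move=> /forallP okB; apply/forallP => i; case/andP: (okB i).
  have [B [pB mB hB]] := forest_partition h_ok.
  rewrite (bigD1 B) /= ?pB ?mB ?eqxx // big1 ?addn0.
    by apply/eqP; rewrite eqb1; apply/forallP => i; rewrite h_ok -hB eqxx.
  move=> B' /andP[/andP[pB' /eqP mB']]; apply: contraNeq.
  rewrite -lt0n lt0b => /forallP okB'; apply/eqP.
  by apply: (forest_partition_uniq h_ok) => // i; case/andP: (okB' i) => _ /eqP.
rewrite -(bigA_distr_bigA (fun i j => parent_ok S i j : nat)) [RHS]big_mkcond /=.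
apply: eq_bigr => i _; rewrite /parent_ok; case: (boolP (i \in S)) => iS /=.
  by rewrite (bigD1 i) //= eqxx big1 // => j /negbTE ->.
rewrite -big_mkcond /=.
rewrite (@big_ord_narrow _ _ _ i n (fun=> 1) (ltnW (ltn_ord i))).
by rewrite sum1_card card_ord.
Qed.

(** * An exchangeable law is determined by its increments *)

Lemma sum_pow2_lt (n m : nat) : m <= n ->
  \sum_(m <= i < n) 2 ^ (n - i) < 2 ^ (n - m).+1.
Proof.
move=> lemn; have [k ->] : exists k, m = n - k by exists (n - m); rewrite subKn.
rewrite leq_eqVlt; apply/orP; right.
elim: k => [|k IHk]; first by rewrite subn0 big_geq // subnn.
have [lenk|ltkn] := leqP n k; first by rewrite (_ : n - k.+1 = n - k) //; lia.
rewrite big_ltn; last by lia.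
have -> : (n - k.+1).+1 = n - k by lia.
have -> : n - (n - k.+1) = (n - (n - k)).+1 by lia.
by move: IHk; rewrite !expnS; lia.
Qed.

(** A numerical form of the lexicographic order on increments: the smaller the
    weight, the later the minima, the earliest position being decisive. *)
Definition weight (n : nat) (S : {set 'I_n}) : nat :=
  \sum_(i in S) 2 ^ (n - i).

Lemma weight_lt (n : nat) (S S' : {set 'I_n}) (m : 'I_n) :
  (forall i : 'I_n, i < m -> (i \in S) = (i \in S')) ->
  m \in S -> m \notin S' -> weight S' < weight S.
Proof.
move=> eqS mS mS'; pose low (U : {set 'I_n}) := \sum_(i in U | i < m) 2 ^ (n - i).
have weightE U : weight U = low U + \sum_(i in U | ~~ (i < m)) 2 ^ (n - i).
  by rewrite /weight (bigID (fun i : 'I_n => i < m)).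
have low_eq : low S = low S'.
  by apply: eq_bigl => i; rewrite andbC [RHS]andbC; case: ltnP => // /eqS.
rewrite !weightE low_eq ltn_add2l.
have leS : 2 ^ (n - m) <= \sum_(i in S | ~~ (i < m)) 2 ^ (n - i).
  by rewrite (bigD1 m) /= ?mS ?ltnn // leq_addr.
apply: leq_trans leS; have ltmn := ltn_ord m.
have -> : n - m = (n - m.+1).+1 by lia.
apply: leq_ltn_trans (sum_pow2_lt ltmn).
rewrite big_geq_mkord big_mkcond [leqRHS]big_mkcond /=; apply: leq_sum => i _.
rewrite -leqNgt [m <= i]leq_eqVlt; case: ifP => [/andP[iS' /orP[/eqP mi|->]]|] //.
by rewrite -(val_inj mi) (negbTE mS') in iS'.
Qed.

Lemma below_subproof (n : nat) (i : 'I_n) : i.-1 < n.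
Proof. exact: leq_ltn_trans (leq_pred i) (ltn_ord i). Qed.

(** The predecessor of i; 0, which is always a minimum, is sent to itself. *)
Definition below (n : nat) (i : 'I_n) : 'I_n := Ordinal (below_subproof i).

(** Every block is an interval of [0, n). *)
Definition interval_partition (n : nat) (B : {set {set 'I_n}}) : bool :=
  [forall i, (i \in minima B) || (pblock B i == pblock B (below i))].

(** A partition into intervals is the partition into trees of the forest in
    which every element other than a minimum has its predecessor as parent. *)
Lemma interval_partition_uniq (n : nat) (B B' : {set {set 'I_n}}) :
  set_partition B -> set_partition B' ->
  interval_partition B -> interval_partition B' -> minima B = minima B' ->
  B = B'.
Proof.
move=> pB pB' /forallP iB /forallP iB' eqM.
pose h := [ffun i => if i \in minima B then i else below i].
apply: (@forest_partition_uniq _ (minima B) h) => // i.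
- rewrite /parent_ok ffunE; case: (boolP (i \in minima B)) => //= iM.
  rewrite /= ltn_predL lt0n; apply: contra iM => /eqP i0; exact: ord0_minima.
- by rewrite ffunE; case: ifPn => // iM; have := iB i; rewrite (negbTE iM) => /eqP.
- rewrite ffunE; case: ifPn => // iM; have := iB' i.
  by rewrite -eqM (negbTE iM) => /eqP.
Qed.

(** Let i be the first element where the interval property fails, and j the last
    element before i in the block of i. Then j + 1 is a minimum, by the choice
    of i and j. Exchanging j + 1 and i puts j + 1 into the block of j, so it is
    no longer a minimum, and leaves all earlier increments unchanged. *)
Lemma relabel_weight_lt (n : nat) (B : {set {set 'I_n}}) :
  set_partition B -> ~~ interval_partition B ->
  exists s, weight (minima (relabel s B)) < weight (minima B).
Proof.
move=> pB /forallPn[i1 bad1].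
pose bad i := ~~ ((i \in minima B) || (pblock B i == pblock B (below i))).
case: (@arg_minnP _ i1 bad val bad1) => i {i1 bad1} bad_i i_min.
have [iM neq_below] := norP bad_i.
have /(minima_lt i pB)[k0 eqik0 ltk0] := iM.
pose before j := (pblock B i == pblock B j) && (j < i).
have : before k0 by rewrite /before eqik0 eqxx.
case/(@arg_maxnP _ k0 before val) => j /andP[/eqP eqij ltji] j_max.
have ltj1i : j.+1 < i.
  rewrite ltn_neqAle ltji andbT; apply: contra neq_below => /eqP j1i.
  rewrite eqij; apply/eqP; congr pblock; apply: val_inj => /=.
  by rewrite -j1i.
pose t := Ordinal (ltn_trans ltj1i (ltn_ord i)).
(* Otherwise t would lie in the block of j, as the interval property holds
   before i, against the choice of j. *)
have tM : t \in minima B.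
  apply: contraT => tM.
  have : ~~ bad t by apply/negP => /i_min /=; rewrite leqNgt ltj1i.
  rewrite negbK (negbTE tM) /= => /eqP eqt.
  have belowt : below t = j by apply: val_inj.
  have /j_max : before t by rewrite /before eqt belowt eqij eqxx.
  by rewrite /= ltnn.
have pB' := relabel_partition (tperm t i) pB.
have same_below (k : 'I_n) : k < t -> tperm t i k = k.
  move=> ltkt; rewrite tpermD // -val_eqE /= eq_sym ltn_eqF //.
  exact: ltn_trans ltkt ltj1i.
exists (tperm t i); apply: (@weight_lt _ _ _ t) => // [k ltkt|].
- rewrite !minimaE //; congr (~~ _); apply: eq_existsb => l.
  case: (ltnP l k) => ltlk; rewrite ?andbF // !andbT -(pblock_relabel (tperm t i)) //.
  by rewrite !same_below // (ltn_trans ltlk).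
- apply/(minima_lt t pB'); exists j => //; apply/eqP.
  rewrite -[X in pblock _ X == _](tpermR t i) -[X in _ == pblock _ X](same_below j) //.
  by rewrite pblock_relabel // eqij.
Qed.

(** Applied to the difference of two exchangeable laws. By induction on the
    weight: d vanishes off interval partitions by relabelling to a smaller
    weight, and an interval partition is then the only term left in the sum over
    the partitions with its minima. *)
Lemma eppf_unique (n : nat) (V : nmodType) (d : {set {set 'I_n}} -> V) :
  (forall s B, set_partition B -> d (relabel s B) = d B) ->
  (forall S, (\sum_(B | set_partition B && (minima B == S)) d B = 0)%R) ->
  forall B, set_partition B -> d B = 0%R.
Proof.
move=> d_relabel d_sum B; have [m] := ubnP (weight (minima B)).
elim: m B => // m IHm B; rewrite ltnS => ltBm pB.
have noninterval0 C : set_partition C -> weight (minima C) <= m ->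
    ~~ interval_partition C -> d C = 0%R.
  move=> pC ltCm /(relabel_weight_lt pC)[s lts]; rewrite -(d_relabel s) //.
  by apply: IHm; [exact: leq_trans lts ltCm|exact: relabel_partition].
have [iB|] := boolP (interval_partition B); last exact: noninterval0.
rewrite -(d_sum (minima B)) (bigD1 B) /= ?pB ?eqxx // big1 ?GRing.addr0 //.
move=> C /andP[/andP[pC /eqP mC] neCB]; apply: noninterval0 => //.
  by rewrite mC.
by apply: contra neCB => iC; apply/eqP; apply: interval_partition_uniq.
Qed.

(** * Extreme partitions, and partitions with a single pair *)

Lemma all_singletons_partition (n : nat) : set_partition (all_singletons n).
Proof.
apply/and3P; split.
- apply/eqP/setP=> i; rewrite inE; apply/bigcupP; exists [set i].
    by apply/imsetP; exists i.
  by rewrite inE.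
- apply/trivIsetP => _ _ /imsetP[i _ ->] /imsetP[j _ ->] neij.
  by rewrite disjoints1 inE; apply: contra neij => /eqP ->.
- by apply/imsetP => -[i _ /setP/(_ i)]; rewrite !inE eqxx.
Qed.

Lemma minima_all_singletons (n : nat) : minima (all_singletons n) = setT.
Proof.
have pB := all_singletons_partition n; apply/setP=> i; rewrite [RHS]inE.
apply/(minimaP i pB) => j /eqP; rewrite eq_pblockT //.
have /and3P[_ tB _] := pB; rewrite (@def_pblock _ _ [set i]) ?inE //.
  by move/eqP->.
by apply/imsetP; exists i.
Qed.

Lemma minima_setT (n : nat) (B : {set {set 'I_n}}) :
  set_partition B -> minima B = setT -> B = all_singletons n.
Proof.
move=> pB mB; have pS := all_singletons_partition n.
apply: partition_ext => // i j.
by rewrite !(inj_in_eq (pblock_inj_minima _)) // ?mB ?minima_all_singletons ?inE.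
Qed.

Lemma one_block_partition (n : nat) : 0 < n -> set_partition (one_block n).
Proof.
move=> n_gt0; apply/and3P; split.
- by rewrite /cover big_set1.
- by apply/trivIsetP => _ _ /set1P -> /set1P ->; rewrite eqxx.
- by rewrite inE; apply/eqP => /setP/(_ (Ordinal n_gt0)); rewrite !inE.
Qed.

Lemma pblock_one_block (n : nat) (i : 'I_n) : pblock (one_block n) i = setT.
Proof.
have pB := one_block_partition (leq_ltn_trans (leq0n i) (ltn_ord i)).
have /and3P[_ tB _] := pB.
by rewrite (@def_pblock _ _ setT) // inE.
Qed.

Lemma one_blockP (n : nat) (B : {set {set 'I_n}}) : 0 < n -> set_partition B ->
  (forall i j, i != j -> pblock B i = pblock B j) -> B = one_block n.
Proof.
move=> n_gt0 pB eqB; apply: partition_ext => //.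
  exact: one_block_partition.
move=> i j; rewrite !pblock_one_block eqxx.
by have [->|/eqB ->] := eqVneq i j; apply/eqP.
Qed.

Lemma prod_block_sizes (n : nat) (B : {set {set 'I_n}}) (f : nat -> nat) :
  \prod_(m <- block_sizes B) f m = \prod_(A in B) f #|(A : {set 'I_n})|.
Proof. by rewrite (perm_big _ (perm_block_sizes B)) big_map big_enum. Qed.

Lemma leq_size_sumn (s : seq nat) : all (fun m => 0 < m) s -> size s <= sumn s.
Proof. by elim: s => //= m s IHs /andP[m_gt0 /IHs]; lia. Qed.

Lemma sumn_eq_size (s : seq nat) :
  all (fun m => 0 < m) s -> sumn s = size s -> s = nseq (size s) 1.
Proof.
elim: s => //= m s IHs /andP[m_gt0 s_gt0] sum_s.
have := leq_size_sumn s_gt0 => le_s.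
by rewrite -IHs //; [congr (_ :: _); lia|lia].
Qed.

Lemma sumn_eqS_size (s : seq nat) :
  all (fun m => 0 < m) s -> sumn s = (size s).+1 ->
  perm_eq s (2 :: nseq (size s).-1 1).
Proof.
elim: s => //= m s IHs /andP[m_gt0 s_gt0] sum_s.
have le_s := leq_size_sumn s_gt0.
have [m1|m_neq1] := eqVneq m 1; last first.
  have -> : m = 2 by lia.
  by rewrite perm_cons -sumn_eq_size //; lia.
have /(IHs s_gt0) ps : sumn s = (size s).+1 by lia.
case: s s_gt0 sum_s le_s ps {IHs} => [|k s] _ sum_s _ ps; first by rewrite m1 in sum_s.
rewrite m1; apply: (@perm_trans _ (1 :: 2 :: nseq (size s) 1)).
  by rewrite perm_cons.
exact: (permEl (perm_catCA [:: 1] [:: 2] (nseq (size s) 1))).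
Qed.

(** There is one block fewer than elements, which leaves room for a single block
    of size 2. *)
Lemma block_sizes_setC1 (n : nat) (B : {set {set 'I_n}}) (i : 'I_n) :
  set_partition B -> minima B = ~: [set i] ->
  perm_eq (block_sizes B) (2 :: nseq n.-2 1).
Proof.
move=> pB mB; have /andP[s_gt0 /eqP sum_s] := block_sizes_composition pB.
have size_s : (size (block_sizes B)).+1 = n.
  rewrite size_block_sizes -card_minima // mB.
  by have := cardsC [set i]; rewrite cards1 card_ord.
have size1 : (size (block_sizes B)).-1 = n.-2 by lia.
by rewrite -size1; apply: sumn_eqS_size; rewrite // sum_s size_s.
Qed.

(** The partner of i can be any smaller element. Here this is read off from
    [sum_cyclic_orders], where all the factorials are 1. *)
Lemma card_minima_setC1 (n : nat) (i : 'I_n) :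
  #|[set B | set_partition B & minima B == ~: [set i]]| = i.
Proof.
transitivity (\prod_(j : 'I_n | j \notin ~: [set i]) (j : nat)); last first.
  by rewrite (big_pred1 i) // => j; rewrite !inE negbK.
rewrite -sum_cyclic_orders -sum1_card.
apply: eq_big => [B|B]; rewrite inE => // /andP[pB /eqP mB].
rewrite -(prod_block_sizes B (fun m => (m.-1)`!)).
by rewrite (perm_big _ (block_sizes_setC1 pB mB)) big_cons big_nseq iter_fix.
Qed.

(** * Exchangeable weights on partitions *)

Local Open Scope classical_set_scope.
Local Open Scope ring_scope.
Import GRing.Theory Num.Theory Order.TTheory.

Lemma prodr_setI (R : comPzRingType) (I : finType) (S : {set I}) (f g : I -> R) :
  \prod_i (if i \in S then f i else g i) =
  (\prod_(i in S) f i) * \prod_(i | i \notin S) g i.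
Proof.
rewrite (bigID (fun i => i \in S)) /=; congr (_ * _); apply: eq_bigr => i.
  by move=> ->.
by move=> /negbTE ->.
Qed.

(** The power of theta and [sum_cyclic_orders] supply the numerators, theta for
    i in S and i otherwise; the denominator of the law of the process supplies
    one factor theta + i for each i. *)
Lemma crp_eppf_mass (R : realType) (n : nat) (theta : R) (S : {set 'I_n}) :
  \sum_(B | set_partition B && (minima B == S))
     crp_eppf theta n (block_sizes B) =
  \prod_(i < n) (if i \in S then theta / (theta + i%:R)
                 else i%:R / (theta + i%:R)).
Proof.
have step (B : {set {set 'I_n}}) : set_partition B && (minima B == S) ->
    crp_eppf theta n (block_sizes B) =
    theta ^+ #|S| / \prod_(i < n) (theta + i%:R) *
    (\prod_(A in B) (#|(A : {set 'I_n})|.-1)`!)%N%:R.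
  move=> /andP[pB /eqP mB].
  rewrite /crp_eppf size_block_sizes -card_minima // mB.
  by rewrite -(prod_block_sizes B (fun m => (m.-1)`!)) natr_prod mulrAC.
rewrite (eq_bigr _ step) -mulr_sumr -natr_sum sum_cyclic_orders.
rewrite prodr_setI !big_split /= prodr_const natr_prod mulrACA.
rewrite [LHS]mulrAC; congr (_ * _).
by rewrite (bigID (fun i => i \in S)) /= !prodfV -invfM.
Qed.

(** By [eppf_unique], it is enough that both laws give the same probability to
    each set of minima. *)
Lemma crp_of_increment_law (R : realType) (n : nat) (theta : R)
    (r : {set {set 'I_n}} -> R) (q : 'I_n -> R) :
  (forall B B', set_partition B -> set_partition B' ->
     perm_eq (block_sizes B) (block_sizes B') -> r B = r B') ->
  (forall S : {set 'I_n}, \sum_(B | set_partition B && (minima B == S)) r B =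
     \prod_i (if i \in S then q i else 1 - q i)) ->
  (forall i : 'I_n, theta + i%:R != 0) ->
  (forall i, q i = theta / (theta + i%:R)) ->
  forall B, set_partition B -> r B = crp_eppf theta n (block_sizes B).
Proof.
move=> r_exch r_mass den_neq0 qE B pB; apply/eqP; rewrite -subr_eq0; apply/eqP.
apply: (eppf_unique (d := fun B => r B - crp_eppf theta n (block_sizes B))) => //.
- move=> s C pC; have psC := relabel_partition s pC.
  rewrite (r_exch _ _ psC pC (block_sizes_relabel s C)); congr (_ - _ / _).
  by rewrite (perm_size (block_sizes_relabel s C)) (perm_big _ (block_sizes_relabel s C)).
- move=> S; rewrite sumrB r_mass crp_eppf_mass; apply/eqP; rewrite subr_eq0.
  apply/eqP/eq_bigr => i _; rewrite qE; case: ifP => // _.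
  by rewrite -[X in X - _](divff (den_neq0 i)) -mulrBl addrC addKr.
Qed.

Lemma exists_perm2 (T : finType) (x y u v : T) : x != y -> u != v ->
  exists s : {perm T}, s x = u /\ s y = v.
Proof.
move=> nexy neuv; exists (tperm x u * tperm (tperm x u y) v)%g.
rewrite !permM tpermL; split; last by rewrite tpermL.
rewrite tpermD // 1?eq_sym //.
by rewrite -[X in X != _](tpermL x u) (inj_eq perm_inj).
Qed.

Section ProductLaw.
Context (R : realType) (n : nat) (r : {set {set 'I_n}} -> R) (q : 'I_n -> R).
Context (r_ge0 : forall B, 0 <= r B).
Context (r_exch : forall B B', set_partition B -> set_partition B' ->
  perm_eq (block_sizes B) (block_sizes B') -> r B = r B').
Context (r_sum : \sum_(B | set_partition B) r B = 1).
Context (r_mass : forall S : {set 'I_n},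
  \sum_(B | set_partition B && (minima B == S)) r B =
  \prod_i (if i \in S then q i else 1 - q i)).
Context (qE : forall i,
  q i = \sum_(B | set_partition B && (i \in minima B)) r B).

Lemma increment_prob_ge0 i : 0 <= q i.
Proof. by rewrite qE sumr_ge0. Qed.

Lemma increment_prob_ord0 (i : 'I_n) : i = 0%N :> nat -> q i = 1.
Proof.
move=> i0; rewrite qE -r_sum; apply: eq_bigl => B.
by apply: andb_idr => pB; apply: ord0_minima.
Qed.

Lemma increment_prob_gt0 B i : set_partition B -> 0 < r B -> i \in minima B -> 0 < q i.
Proof.
move=> pB rB iM; rewrite qE (bigD1 B) /= ?pB // ltr_pwDl //.
exact: sumr_ge0.
Qed.

Lemma exch_relabel s B : set_partition B -> r (relabel s B) = r B.
Proof.
by move=> pB; apply: r_exch => //; [exact: relabel_partition|exact: block_sizes_relabel].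
Qed.

(** A partition with two elements x, y in different blocks has a relabelling
    that sends x, y to 0, 1, and there 1 is a minimum. *)
Lemma one_block_of_never_split (i1 : 'I_n) : i1 = 1%N :> nat -> q i1 = 0 ->
  r (one_block n) = 1.
Proof.
move=> i1E q1; have n_gt1 : (1 < n)%N by rewrite -i1E ltn_ord.
have n_gt0 := ltnW n_gt1; have p1 := one_block_partition n_gt0.
rewrite -r_sum (bigD1 (one_block n)) //= [X in _ + X]big1 ?addr0 //.
move=> B /andP[pB]; apply: contraNeq => rB_neq0; apply/eqP/one_blockP => // x y nexy.
have ne01 : Ordinal n_gt0 != i1 by rewrite -val_eqE /= i1E.
have [s [sx sy]] := exists_perm2 nexy ne01.
have psB := relabel_partition s pB.
have : i1 \notin minima (relabel s B).
  apply/negP => i1M; suff : 0 < q i1 by rewrite q1 ltxx.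
  by apply: (increment_prob_gt0 psB) i1M; rewrite exch_relabel // lt_def rB_neq0 r_ge0.
move=> /(minima_lt i1 psB)[j /eqP eq1j ltj1]; apply/eqP.
rewrite -(pblock_relabel s) // sx sy eq_sym (_ : Ordinal n_gt0 = j) //.
by apply: val_inj => /=; lia.
Qed.

(** By the product formula, the set S of all i with q_i > 0 is the set of minima
    of some B of positive weight. The minima of a relabelling of B lie in S and
    are equally many, so they are S again, hence contain 0 and 1. Relabelling
    any two elements of B to 0 and 1 shows that they lie in different blocks,
    so S is everything. *)
Lemma increment_prob_positive (i1 : 'I_n) : i1 = 1%N :> nat -> q i1 != 0 ->
  forall i, 0 < q i.
Proof.
move=> i1E q1 i; have n_gt1 : (1 < n)%N by rewrite -i1E ltn_ord.
have n_gt0 := ltnW n_gt1; pose i0 := Ordinal n_gt0.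
pose S : {set 'I_n} := [set i | 0 < q i]%SET.
have [B /andP[/andP[pB /eqP mB] rB]] :
    exists B, (set_partition B && (minima B == S)) && (0 < r B).
  apply: psumr_neq0P => //; rewrite r_mass; apply/eqP/prodf_neq0 => j _.
  rewrite inE; case: ifPn.
    by move/lt0r_neq0.
  rewrite -leNgt => qj; rewrite (_ : q j = 0) ?subr0 ?oner_eq0 //.
  by apply/le_anti; rewrite qj increment_prob_ge0.
have mS s : minima (relabel s B) = S.
  have psB := relabel_partition s pB.
  apply/eqP; rewrite eqEcard; apply/andP; split.
    apply/subsetP => j jM; rewrite inE.
    by apply: (increment_prob_gt0 psB) jM; rewrite exch_relabel.
  by rewrite card_minima // card_relabel -card_minima // mB.
have i0S : i0 \in S by rewrite inE increment_prob_ord0.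
have i1S : i1 \in S by rewrite inE lt_def q1 increment_prob_ge0.
suff : i \in S by rewrite inE.
rewrite -mB; apply/(minimaP i pB) => j; have [->//|neij] := eqVneq i j.
have ne01 : i0 != i1 by rewrite -val_eqE /= i1E.
have [s [si sj]] := exists_perm2 neij ne01.
move/eqP; rewrite -(pblock_relabel s) // si sj => /eqP.
move/(pblock_inj_minima (relabel_partition s pB)); rewrite mS => /(_ i0S i1S).
by move/eqP; rewrite (negbTE ne01).
Qed.

(** g is the common weight of the partitions with one pair and singletons; the
    two sides are the mass of those in which i is the only element that is not
    a minimum. The element 1 serves to exhibit one such partition. *)
Lemma one_missing_mass (i1 : 'I_n) : i1 = 1%N :> nat ->
  exists2 g, 0 <= g & forall i : 'I_n, (0 < i)%N ->
    (1 - q i) * \prod_(j | j != i) q j = i%:R * g.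
Proof.
move=> i1E; have [B1] : exists B1, B1 \in
    [set B | set_partition B & minima B == ~: [set i1]]%SET.
  by apply/set0Pn; rewrite -card_gt0 card_minima_setC1 i1E.
rewrite inE => /andP[pB1 /eqP mB1]; exists (r B1) => // i i_gt0.
have <- : \prod_j (if j \in ~: [set i] then q j else 1 - q j) =
    (1 - q i) * \prod_(j | j != i) q j.
  rewrite (bigD1 i) //= !inE eqxx; congr (_ * _).
  by apply: eq_bigr => j neji; rewrite !inE neji.
rewrite -r_mass (eq_bigr (fun=> r B1)) => [|B /andP[pB /eqP mB]]; last first.
  apply: r_exch => //; apply: perm_trans (block_sizes_setC1 pB mB) _.
  by rewrite perm_sym; apply: block_sizes_setC1 mB1.
rewrite sumr_const mulr_natl; congr (_ *+ _).
by rewrite -[RHS]card_minima_setC1; apply: eq_card => B; rewrite inE.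
Qed.

(** With Q the product of all q_i, [one_missing_mass] reads
    (1 - q_i) Q = i q_i g, so theta is Q / g unless g = 0. For n = 1 every theta
    fits, and 1 is chosen. *)
Lemma increment_prob_crp_or_degenerate : (0 < n)%N ->
  (exists theta : R, 0 < theta /\ forall i, q i = theta / (theta + i%:R)) \/
  (1 < n)%N /\ (r (one_block n) = 1 \/ r (all_singletons n) = 1).
Proof.
move=> n_gt0; have [n_gt1|n_le1] := ltnP 1 n; last first.
  left; exists 1; split=> // i; have i0 : i = 0%N :> nat by have := ltn_ord i; lia.
  by rewrite increment_prob_ord0 // i0 addr0 divff ?oner_eq0.
pose i1 := Ordinal n_gt1; have i1E : i1 = 1%N :> nat by [].
have [/(one_block_of_never_split i1E)|q1] := eqVneq (q i1) 0.
  by right; split; last left.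
have qpos := increment_prob_positive i1E q1.
have [g g_ge0 gE] := one_missing_mass i1E.
pose Q := \prod_i q i; have Q_gt0 : 0 < Q by apply: prodr_gt0.
have QE (i : 'I_n) : (0 < i)%N -> (1 - q i) * Q = q i * (i%:R * g).
  by move=> i_gt0; rewrite -gE // /Q (bigD1 i) //= mulrCA.
have [g0|g_neq0] := eqVneq g 0.
  right; split=> //; right.
  have q_one i : q i = 1.
    have [i0|i_gt0] := posnP i; first exact: increment_prob_ord0.
    have /eqP := QE i i_gt0; rewrite g0 !mulr0 mulf_eq0 (gt_eqF Q_gt0) orbF.
    by rewrite subr_eq0 => /eqP.
  have := r_mass setT; rewrite [RHS]big1 => [|i _]; last by rewrite inE.
  rewrite (big_pred1 (all_singletons n)) // => B.
  apply/andP/eqP => [[pB /eqP mB]|->]; first exact: minima_setT.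
  by rewrite all_singletons_partition minima_all_singletons.
have g_gt0 : 0 < g by rewrite lt_def g_neq0.
left; exists (Q / g); split=> [|i]; first exact: divr_gt0.
have [i0|i_gt0] := posnP i.
  by rewrite increment_prob_ord0 // i0 addr0 divff // gt_eqF ?divr_gt0.
have den_neq0 : Q / g + i%:R != 0.
  by rewrite gt_eqF // ltr_wpDr // divr_gt0.
apply: (mulIf den_neq0); rewrite divfK // mulrDr.
apply: (mulIf g_neq0); rewrite mulrDl -!mulrA (mulVf g_neq0) mulr1 -QE //.
by rewrite mulrBl mul1r addrC subrK.
Qed.

End ProductLaw.

(** * Events defined by a random partition *)

Lemma increment_minima (n : nat) (B : {set {set 'I_n}}) (i : 'I_n) :
  increment B i = (i \in minima B).
Proof. by rewrite inE /increment; case: ifP. Qed.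

Section Law.
Context (R : realType) (d : measure_display) (T : measurableType d)
  (P : probability T R) (n : nat) (Pi : T -> {set {set 'I_n}}).
Context (hPi : random_partition Pi).

Definition mass (B : {set {set 'I_n}}) : R := fine (P [set w | Pi w = B]).

Lemma measurable_event (C : pred {set {set 'I_n}}) :
  measurable [set w | C (Pi w)].
Proof. by case: hPi => _ /(_ [set B | C B]). Qed.

Lemma measurable_atom B : measurable [set w | Pi w = B].
Proof. by case: hPi => _ /(_ [set B]). Qed.

Lemma massE B : P [set w | Pi w = B] = (mass B)%:E.
Proof. by rewrite fineK // fin_num_measure //; apply: measurable_atom. Qed.

Lemma mass_ge0 B : 0 <= mass B.
Proof. exact: fine_ge0. Qed.

Lemma probability_event (C : pred {set {set 'I_n}}) :
  P [set w | C (Pi w)] = (\sum_(B | set_partition B && C B) mass B)%:E.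
Proof.
pose CP B := set_partition B && C B.
transitivity (P [set w | Pi w \in enum CP]).
  congr (P _); apply/seteqP; split => w /=; rewrite mem_enum /CP unfold_in.
    by move=> ->; case: hPi => ->.
  by case/andP.
rewrite -big_enum; elim: (enum CP) (enum_uniq CP) => [|B s IHs] /=.
  by move=> _; rewrite big_nil -[RHS](measure0 P); congr (P _); apply/seteqP; split.
move=> /andP[Bs us]; rewrite big_cons EFinD -IHs // -massE -measureU.
- congr (P _); apply/seteqP; split => w /=; rewrite inE.
    by case/orP => [/eqP|]; [left|right].
  by case=> ->; rewrite ?eqxx ?orbT.
- exact: measurable_atom.
- exact: (measurable_event (fun B => B \in s)).
- by apply/seteqP; split=> // w /= [-> Bs']; rewrite Bs' in Bs.
Qed.

Lemma mass_sum1 : \sum_(B | set_partition B) mass B = 1.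
Proof.
apply: EFin_inj.
rewrite (_ : (1%:E)%E = P [set w | xpredT (Pi w)]); last first.
  by rewrite -(probability_setT P); congr (P _); apply/seteqP; split.
rewrite (probability_event xpredT); congr EFin; apply: eq_bigl => B.
by rewrite andbT.
Qed.

Definition increment_prob (i : 'I_n) : R :=
  \sum_(B | set_partition B && (i \in minima B)) mass B.

Lemma independent_mass :
  independent_RVs P (fun (i : 'I_n) (w : T) => increment (Pi w) i) ->
  forall S : {set 'I_n}, \sum_(B | set_partition B && (minima B == S)) mass B =
    \prod_i (if i \in S then increment_prob i else 1 - increment_prob i).
Proof.
move=> indep S; apply: EFin_inj; rewrite -probability_event -prodEFin.
have := indep [set: 'I_n]%SET (fun i => [set (i \in S : nat)]) (fun=> I).
have -> : \bigcap_(i in [set i | i \in [set: 'I_n]%SET])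
     (fun w => increment (Pi w) i) @^-1` [set (i \in S : nat)] =
   [set w | minima (Pi w) == S].
  apply/seteqP; split => w /=.
    move=> inc; apply/eqP/setP => i; have := inc i (in_setT i).
    by rewrite /= increment_minima; case: (i \in minima _); case: (i \in S).
  by move=> /eqP mw i _ /=; rewrite increment_minima mw.
move=> ->; apply: eq_big => [i|i _]; first by rewrite inE.
transitivity (P [set w | (i \in minima (Pi w)) == (i \in S)]).
  congr (P _); apply/seteqP; split => w /=; rewrite increment_minima.
    by case: (i \in minima _); case: (i \in S).
  by move=> /eqP ->.
rewrite (probability_event (fun B => (i \in minima B) == (i \in S))).
congr EFin; case: ifP => iS.
  by apply: eq_bigl => B; rewrite eqb_id.
apply: (addrI (increment_prob i)); rewrite addrCA subrr addr0 -mass_sum1.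
rewrite [RHS](bigID (fun B => i \in minima B)) /=; congr (_ + _).
by apply: eq_bigl => B; rewrite eqbF_neg.
Qed.

(** The event that X_i lies in A_i for all i in K is a sum over all possible
    sets of minima; the sum of products distributes into a product of sums, in
    which the factors outside K are 1. Taking K = J and each K = {i} gives the
    two sides of the independence equation. *)
Lemma product_mass_independent (w : 'I_n -> bool -> R) :
  (forall i, w i true + w i false = 1) ->
  (forall S : {set 'I_n}, \sum_(B | set_partition B && (minima B == S)) mass B =
     \prod_i w i (i \in S)) ->
  independent_RVs P (fun (i : 'I_n) (w : T) => increment (Pi w) i).
Proof.
move=> w_sum1 w_mass J A _.
pose a i (b : bool) : R := (`[< A i (b : nat) >] : nat)%:R.
have PJ (K : {set 'I_n}) :
    P (\bigcap_(i in [set i | i \in K]) (fun x => increment (Pi x) i) @^-1` A i) =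
    (\prod_(i in K) (a i true * w i true + a i false * w i false))%:E.
  pose C (S : {set 'I_n}) := [forall i in K, `[< A i (i \in S : nat) >]].
  transitivity (P [set x | C (minima (Pi x))]).
    congr (P _); apply/seteqP; split => x /=.
      move=> AK; apply/forall_inP => i iK; apply/asboolP.
      by rewrite -increment_minima; exact: (AK i iK).
    by move=> /forall_inP AK i iK /=; rewrite increment_minima; apply/asboolP/AK.
  rewrite (probability_event (fun B => C (minima B))); congr EFin.
  (* Indices outside K carry no constraint, hence the factor 1. *)
  pose u i b := (if i \in K then a i b else 1) * w i b.
  transitivity (\prod_i (u i true + u i false)); last first.
    rewrite [RHS]big_mkcond; apply: eq_bigr => i _; rewrite /u.
    by case: ifP => // _; rewrite !mul1r.
  rewrite bigA_distr /= (partition_big (@minima n) xpredT) //=.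
  apply: eq_bigr => S _.
  have -> : \prod_i (if i \in S then u i true else u i false) =
      (C S : nat)%:R * \prod_i w i (i \in S).
    rewrite (eq_bigr (fun i => (if i \in K then a i (i \in S) else 1) * w i (i \in S))).
      rewrite big_split -big_mkcond /= -natr_prod; congr (_%:R * _).
      have [/forall_inP CS|/forall_inPn[i iK nA]] := boolP (C S).
        by rewrite big1 // => i /CS ->.
      by rewrite (bigD1 i) //= (negbTE nA) mul0n.
    by move=> i _; rewrite /u; case: (i \in S).
  rewrite -w_mass; have [CS|CS] := boolP (C S).
    rewrite mul1r; apply: eq_bigl => B; rewrite -andbA; congr (_ && _).
    by case: eqP => [->|]; rewrite ?CS ?andbF.
  rewrite mul0r big_pred0 // => B; apply/negbTE; apply: contra CS.
  by move=> /andP[/andP[_ CB] /eqP <-].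
rewrite PJ -prodEFin; apply: eq_bigr => i _.
have := PJ [set i]%SET; rewrite big_set1 => <-; congr (P _).
apply/seteqP; split => x /=; first by move/(_ i (set11 i)).
by move=> Ai j /set1P ->.
Qed.

End Law.

Theorem theorem2 (R : realType) (d : measure_display) (T : measurableType d)
    (P : probability T R) (n : nat) (Pi : T -> {set {set 'I_n}})
    (hn : (0 < n)%N) (hPi : random_partition Pi) (hex : exchangeable P Pi) :
  independent_RVs P (fun (i : 'I_n) (w : T) => increment (Pi w) i) <->
  (exists theta : R, 0 < theta /\ has_CRP_law P theta Pi) \/
  ((1 < n)%N /\ (P [set w | Pi w = one_block n] = 1%:E \/
                 P [set w | Pi w = all_singletons n] = 1%:E)).
Proof.
have [p [pE p_sym]] := hex.
have massP B : P [set w | Pi w = B] = (mass P Pi B)%:E by exact: massE.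
have mass_exch B B' : set_partition B -> set_partition B' ->
    perm_eq (block_sizes B) (block_sizes B') -> mass P Pi B = mass P Pi B'.
  move=> pB pB' eq_sizes; rewrite /mass !pE //=.
  by apply: p_sym => //; exact: block_sizes_composition.
split=> [indep|].
  have law := independent_mass hPi indep.
  have [[theta [theta_gt0 qE]]|[n_gt1 degenerate]] := increment_prob_crp_or_degenerate
    (mass_ge0 P Pi) mass_exch (mass_sum1 P hPi) law (fun=> erefl) hn.
  - left; exists theta; split=> // B pB; rewrite massP; congr EFin.
    apply: crp_of_increment_law mass_exch law _ qE _ pB => i.
    by rewrite gt_eqF // ltr_wpDr.
  - by right; split=> //; case: degenerate => r1; [left|right]; rewrite massP r1.
(* If the partition is almost surely B0, its increments are constants. *)
have dirac (B0 : {set {set 'I_n}}) : P [set w | Pi w = B0] = 1%:E ->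
    set_partition B0 ->
    independent_RVs P (fun (i : 'I_n) (w : T) => increment (Pi w) i).
  move=> B0_sure pB0.
  apply: (product_mass_independent hPi
    (w := fun i b => ((i \in minima B0) == b : nat)%:R)) => [i|S].
    by case: (i \in _); rewrite /= ?addr0 ?add0r.
  have mass1 : mass P Pi B0 = 1 by rewrite /mass B0_sure.
  have mass0 B : set_partition B -> B != B0 -> mass P Pi B = 0.
    have /eqP := mass_sum1 P hPi; rewrite (bigD1 B0) //= mass1.
    rewrite -subr_eq0 addrAC subrr add0r psumr_eq0 => [/allP all0|B' _]; last first.
      exact: mass_ge0.
    move=> pB neB; apply/eqP; have := all0 B (mem_index_enum B).
    by rewrite pB neB.
  have -> : \prod_i ((i \in minima B0) == (i \in S) : nat)%:R =
      (minima B0 == S : nat)%:R :> R.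
    rewrite -natr_prod prodn_bool; congr ((_ : bool) : nat)%:R.
    by apply/forallP/eqP => [eqS|-> //]; apply/setP => i; apply/eqP.
  have [<-|neS] := eqVneq (minima B0) S.
    rewrite (bigD1 B0) ?pB0 ?eqxx //= mass1 big1 ?addr0 // => B.
    by move=> /andP[/andP[pB _]]; apply: mass0.
  apply: big1 => B /andP[pB /eqP mB]; apply: mass0 => //.
  by apply: contraNneq neS => <-; apply/eqP.
case=> [[theta [theta_gt0 crp]]|[n_gt1 [sure|sure]]].
- have den_neq0 (i : 'I_n) : theta + i%:R != 0 by rewrite gt_eqF // ltr_wpDr.
  apply: (product_mass_independent hPi (w := fun i (b : bool) =>
    if b then theta / (theta + i%:R) else i%:R / (theta + i%:R))) => [i|S].
    by rewrite -mulrDl divff.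
  rewrite -crp_eppf_mass; apply: eq_bigr => B /andP[pB _].
  by rewrite /mass crp.
- exact: dirac sure (one_block_partition hn).
- exact: dirac sure (all_singletons_partition n).
Qed.
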